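(* Let $R$ be an associative ring with identity. The additive equivalence $F_R:\mathsf{Klcrep}_{\mathbb Z}(R)\to R\text{-}\mathsf{free}_{\mathbb Z}$, $(X,\varrho)\mapsto M_{\varrho}$, restricts to an additive equivalence $$\mathsf{Klcrep}_{\mathbb Z}^{\mathrm{flat}}(R)\simeq (R\text{-}\mathsf{free}_{\mathbb Z})_{\mathrm{flat}},$$ where $\mathsf{Klcrep}_{\mathbb Z}^{\mathrm{flat}}(R)$ is the full subcategory of flat Kleisli convolution representations and $(R\text{-}\mathsf{free}_{\mathbb Z})_{\mathrm{flat}}$ is the full subcategory of $R\text{-}\mathsf{free}_{\mathbb Z}$ consisting of flat modules.
   Context: All modules are unital left modules, ring homomorphisms are unital. Let $\mathbf 1=\{\bullet\}$, and for a finite set $X$ put $E_X=X\times X$. For a set $X$, $\mathcal M_{\mathbb Z}(X)$ is the free Abelian group of finite formal sums $\sum_{x\in X}a_x[x]$, $a_x\in\mathbb Z$; $\mathscr M_{\mathbb Z}$ is the corresponding free Abelian group monad on $\mathsf{Set}$ (unit $x\mapsto[x]$, multiplication given by expanding formal sums of formal sums). A Kleisli arrow $f:X\rightsquigarrow Y$ is a map $f:X\to\mathcal M_{\mathbb Z}(Y)$, $f(x)=\sum_y f_{y,x}[y]$, with matrix $[f]=(f_{y,x})$; Kleisli composition satisfies $[h\circ_{\mathsf{Kl}}f]=[h][f]$. For finite $X$, $\mathbb H_{\mathbb Z}(X)=\mathrm{Hom}_{\mathsf{Kl}(\mathscr M_{\mathbb Z})}(\mathbf 1,E_X)$ is a ring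 with pointwise addition and Kleisli convolution as multiplication: if $f(\bullet)=\sum f_{i,j}[(i,j)]$ and $g(\bullet)=\sum g_{i,j}[(i,j)]$ then $(f\ast g)(\bullet)=\sum_{i,q}(\sum_j f_{i,j}g_{j,q})[(i,q)]$; its unit is $u_X(\bullet)=\sum_x[(x,x)]$. $\Phi_X:\mathbb H_{\mathbb Z}(X)\to\mathrm{Mat}_X(\mathbb Z)$, $f\mapsto(f_{i,j})$, is a ring isomorphism. A Kleisli convolution representation of $R$ is a pair $(X,\varrho)$ with $X$ a finite set and $\varrho:R\to\mathbb H_{\mathbb Z}(X)$ a unital ring homomorphism. A homomorphism $(X,\varrho_X)\to(Y,\varrho_Y)$ is a Kleisli arrow $f:X\rightsquigarrow Y$ with $\Phi_Y(\varrho_Y(r))[f]=[f]\Phi_X(\varrho_X(r))$ for all $r\in R$. These form the additive category $\mathsf{Klcrep}_{\mathbb Z}(R)$ under Kleisli composition (morphisms are added via matrices). $R\text{-}\mathsf{free}_{\mathbb Z}$ is the full subcategory of finitely generated left $R$-modules whose underlying Abelian groups are free of finite rank. The functor $F_R$ sends $(X,\varrho)$ to $M_{\varrho}=\mathcal M_{\mathbb Z}(X)\cong\mathbb Z^{(X)}$ with action $r\cdot v=\Phi_X(\varrho(r))v$, and sends $f$ to the additive map $[x]\mapsto f(x)$; it is an additive equivalence. An object $(X,\varrho)$ of $\mathsf{Klcrep}_{\mathbb Z}(R)$ is a flat Kleisli convolution representation if the left $R$-module $M_{\varrho}$ is flat. *)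

(* Defs.v *)
From HB Require Import structures.
From mathcomp Require Import all_boot all_order all_algebra.
From mathcomp Require Import generic_quotient ring_quotient.
From mathcomp Require Import freeg boolp.

Set Implicit Arguments.
Unset Strict Implicit.
Unset Printing Implicit Defensive.

Import GRing.Theory.
Local Open Scope ring_scope.
Local Open Scope quotient_scope.

(* Preadditive categories: the hom-sets are Abelian groups and composition is
   bilinear. *)
Record preadditive := Preadditive {
  ob :> Type;
  hom : ob -> ob -> zmodType;
  idm : forall X, hom X X;
  comp : forall X Y Z, hom Y Z -> hom X Y -> hom X Z;
  compA : forall X Y Z T (h : hom Z T) (g : hom Y Z) (f : hom X Y),
    comp h (comp g f) = comp (comp h g) f;
  comp1m : forall X Y (f : hom X Y), comp (idm Y) f = f;
  compm1 : forall X Y (f : hom X Y), comp f (idm X) = f;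
  compDl : forall X Y Z (g g' : hom Y Z) (f : hom X Y),
    comp (g + g') f = comp g f + comp g' f;
  compDr : forall X Y Z (g : hom Y Z) (f f' : hom X Y),
    comp g (f + f') = comp g f + comp g f'
}.
Arguments hom {_} _ _.
Arguments idm {_} _.
Arguments comp {_ _ _ _} _ _.

Definition is_iso (C : preadditive) (X Y : C) (f : hom X Y) : Prop :=
  exists g : hom Y X, comp g f = idm X /\ comp f g = idm Y.

Definition is_zero_object (C : preadditive) (Z : C) : Prop :=
  forall X : C, (forall f : hom X Z, f = 0) /\ (forall f : hom Z X, f = 0).

Definition is_biproduct (C : preadditive) (X Y P : C)
    (i1 : hom X P) (i2 : hom Y P) (p1 : hom P X) (p2 : hom P Y) : Prop :=
  [/\ comp p1 i1 = idm X, comp p2 i2 = idm Y, comp p1 i2 = 0, comp p2 i1 = 0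
    & comp i1 p1 + comp i2 p2 = idm P].

(* Existence of a zero object and of binary biproducts. *)
Definition is_additive_category (C : preadditive) : Prop :=
  (exists Z : C, is_zero_object Z) /\
  (forall X Y : C, exists P i1 i2 p1 p2, @is_biproduct C X Y P i1 i2 p1 p2).

Record functor (C D : preadditive) := Functor {
  fob :> C -> D;
  fmor : forall X Y : C, hom X Y -> hom (fob X) (fob Y);
  fmor1 : forall X : C, fmor (idm X) = idm (fob X);
  fmorM : forall (X Y Z : C) (g : hom Y Z) (f : hom X Y),
    fmor (comp g f) = comp (fmor g) (fmor f)
}.
Arguments fmor {C D} _ {X Y} _.

Definition is_additive_functor (C D : preadditive) (F : functor C D) : Prop :=
  forall (X Y : C) (f g : hom X Y), fmor F (f + g) = fmor F f + fmor F g.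

Definition id_functor (C : preadditive) : functor C C :=
  @Functor C C (fun X => X) (fun _ _ f => f) (fun _ => erefl)
    (fun _ _ _ _ _ => erefl).

Section CompFunctor.
Variables (C D E : preadditive) (G : functor D E) (F : functor C D).

Fact comp_functor1 (X : C) : fmor G (fmor F (idm X)) = idm (G (F X)).
Proof. by rewrite !fmor1. Qed.

Fact comp_functorM (X Y Z : C) (g : hom Y Z) (f : hom X Y) :
  fmor G (fmor F (comp g f)) = comp (fmor G (fmor F g)) (fmor G (fmor F f)).
Proof. by rewrite !fmorM. Qed.

Definition comp_functor : functor C E :=
  @Functor C E (fun X => G (F X)) (fun _ _ f => fmor G (fmor F f))
    comp_functor1 comp_functorM.
End CompFunctor.

Definition nat_isomorphic (C D : preadditive) (F G : functor C D) : Prop :=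
  exists eta : forall X : C, hom (F X) (G X),
    (forall (X Y : C) (f : hom X Y),
       comp (eta Y) (fmor F f) = comp (fmor G f) (eta X)) /\
    (forall X : C, is_iso (eta X)).

Definition is_equivalence (C D : preadditive) (F : functor C D) : Prop :=
  exists G : functor D C,
    nat_isomorphic (comp_functor G F) (id_functor C) /\
    nat_isomorphic (comp_functor F G) (id_functor D).

Definition is_additive_equivalence (C D : preadditive) (F : functor C D) :
    Prop :=
  [/\ is_additive_category C, is_additive_category D,
      is_additive_functor F & is_equivalence F].

Definition full_subcat (C : preadditive) (P : C -> Prop) : preadditive :=
  @Preadditive {X : C | P X} (fun X Y => hom (proj1_sig X) (proj1_sig Y))
    (fun X => idm (proj1_sig X)) (fun _ _ _ g f => comp g f)
    (fun _ _ _ _ => @compA C _ _ _ _) (fun _ _ => @comp1m C _ _)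
    (fun _ _ => @compm1 C _ _) (fun _ _ _ => @compDl C _ _ _)
    (fun _ _ _ => @compDr C _ _ _).

Definition restrict_functor (C D : preadditive) (F : functor C D)
    (P : C -> Prop) (Q : D -> Prop) (PQ : forall X, P X -> Q (F X)) :
    functor (full_subcat P) (full_subcat Q) :=
  @Functor (full_subcat P) (full_subcat Q)
    (fun X => exist Q (F (proj1_sig X)) (PQ _ (proj2_sig X)))
    (fun X Y => @fmor C D F (proj1_sig X) (proj1_sig Y))
    (fun X => fmor1 F (proj1_sig X))
    (fun X Y Z => @fmorM C D F (proj1_sig X) (proj1_sig Y) (proj1_sig Z)).

Definition linhom (R : pzRingType) (M N : lmodType R) : Type :=
  {linear M -> N}.
Identity Coercion linear_of_linhom : linhom >-> GRing.Linear.type.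

Section LinHom.
Variables (R : pzRingType) (M N : lmodType R).
Implicit Types f g h : linhom M N.

(* zmodType extends choiceType; the equality test and the choice operator on
   linear maps are the classical ones. *)
HB.instance Definition _ := gen_eqMixin (linhom M N).
HB.instance Definition _ := gen_choiceMixin (linhom M N).

Lemma linhomP f g : f =1 g -> f = g.
Proof.
case: f g => [f [[Df] [Zf]]] [g [[Dg] [Zg]]] /= /funext fg.
by case: _ / fg in Dg Zg *; rewrite (Prop_irrelevance Df Dg) (Prop_irrelevance Zf Zg).
Qed.

Definition linhom_zero : linhom M N := (\0 : {linear M -> N}).
Definition linhom_opp f : linhom M N := (\- f : {linear M -> N}).
Definition linhom_add f g : linhom M N := (f \+ g : {linear M -> N}).

Fact linhom_addA : associative linhom_add.
Proof. by move=> f g h; apply: linhomP => x /=; rewrite addrA. Qed.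
Fact linhom_addC : commutative linhom_add.
Proof. by move=> f g; apply: linhomP => x /=; rewrite addrC. Qed.
Fact linhom_add0 : left_id linhom_zero linhom_add.
Proof. by move=> f; apply: linhomP => x /=; rewrite add0r. Qed.
Fact linhom_addN : left_inverse linhom_zero linhom_opp linhom_add.
Proof. by move=> f; apply: linhomP => x /=; rewrite addNr. Qed.

HB.instance Definition _ := GRing.isZmodule.Build (linhom M N)
  linhom_addA linhom_addC linhom_add0 linhom_addN.
End LinHom.

Section ModCat.
Variable R : pzRingType.
Implicit Types M N P Q : lmodType R.

Definition linhom_id M : linhom M M := (idfun : {linear M -> M}).
Definition linhom_comp M N P (g : linhom N P) (f : linhom M N) : linhom M P :=
  (g \o f : {linear M -> P}).

Fact linhom_compA M N P Q (h : linhom P Q) (g : linhom N P) (f : linhom M N) :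
  linhom_comp h (linhom_comp g f) = linhom_comp (linhom_comp h g) f.
Proof. exact: linhomP. Qed.
Fact linhom_comp1m M N (f : linhom M N) : linhom_comp (linhom_id N) f = f.
Proof. exact: linhomP. Qed.
Fact linhom_compm1 M N (f : linhom M N) : linhom_comp f (linhom_id M) = f.
Proof. exact: linhomP. Qed.
Fact linhom_compDl M N P (g g' : linhom N P) (f : linhom M N) :
  linhom_comp (g + g') f = linhom_comp g f + linhom_comp g' f.
Proof. exact: linhomP. Qed.
Fact linhom_compDr M N P (g : linhom N P) (f f' : linhom M N) :
  linhom_comp g (f + f') = linhom_comp g f + linhom_comp g f'.
Proof. by apply: linhomP => x /=; rewrite linearD. Qed.

Definition modcat : preadditive :=
  @Preadditive (lmodType R) (fun M N => linhom M N) linhom_id linhom_comp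
    linhom_compA linhom_comp1m linhom_compm1 linhom_compDl linhom_compDr.

Definition finitely_generated M : Prop :=
  exists n (e : 'I_n -> M), forall v : M,
    exists c : 'I_n -> R, v = \sum_i c i *: e i.
End ModCat.

Definition free_of_finite_rank (A : zmodType) : Prop :=
  exists n (e : 'I_n -> A), forall v : A,
    exists! c : {ffun 'I_n -> int}, v = \sum_i e i *~ c i.

Definition R_free (R : pzRingType) : preadditive :=
  full_subcat (fun M : modcat R =>
    finitely_generated M /\ free_of_finite_rank M).

Section Monad.
Implicit Types X Y : choiceType.

Definition MZunit X (x : X) : {freeg X} := << x >>.
Definition MZmap X Y (h : X -> Y) (v : {freeg X}) : {freeg Y} :=
  fglift (fun x => MZunit (h x)) v.
Definition MZmul X (w : {freeg {freeg X}}) : {freeg X} := fglift id w.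
End Monad.

Section FreeGroup.
Variables (K : choiceType) (M : lmodType int) (f : K -> M).

HB.instance Definition _ := GRing.isZmodMorphism.Build {freeg K} M (fglift f)
  (lift_is_additive f).

Lemma fglift_unit x : fglift f << x >> = f x.
Proof. by rewrite liftU scale1r. Qed.
End FreeGroup.

Lemma freeg_ext (K : choiceType) (A : zmodType) (f g : {additive {freeg K} -> A}) :
  (forall x, f << x >> = g << x >>) -> f =1 g.
Proof.
move=> fg v; rewrite -[v]freeg_sumE !raddf_sum; apply: eq_bigr => x _.
by rewrite -[coeff x v]intz -freegU_mulz !raddfMz fg.
Qed.

Section Kleisli.
Implicit Types X Y Z : finType.

Definition kleisli X Y : Type := {ffun X -> {freeg Y}}.
HB.instance Definition _ X Y := GRing.Zmodule.copy (kleisli X Y)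
  {ffun X -> {freeg Y}}.

Definition kl_id X : kleisli X X := [ffun x => MZunit x].
Definition kl_comp X Y Z (h : kleisli Y Z) (f : kleisli X Y) : kleisli X Z :=
  [ffun x => MZmul (MZmap h (f x))].

(* The entry f_{y,x} sits in row y and column x; the elements of a finite set
   are numbered by [enum_val]. *)
Definition kl_mat X Y (f : kleisli X Y) : 'M[int]_(#|Y|, #|X|) :=
  \matrix_(i, j) coeff (enum_val i) (f (enum_val j)).

Lemma MZmul_map (K : choiceType) Z (h : K -> {freeg Z}) (v : {freeg K}) :
  MZmul (MZmap h v) = fglift h v.
Proof.
apply: (@freeg_ext _ _ (fglift id \o fglift (fun x => MZunit (h x))) (fglift h)) => x /=.
by rewrite !fglift_unit.
Qed.

Lemma sum_enum_val (A : nmodType) X (F : X -> A) :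
  \sum_(i < #|X|) F (enum_val i) = \sum_x F x.
Proof. by rewrite -(big_enum_val _ (A := X)); apply: eq_bigl. Qed.

Lemma freeg_finE X (v : {freeg X}) : v = \sum_x << coeff x v *g x >>.
Proof.
apply/eqP/freeg_eqP => y; rewrite raddf_sum (bigD1 y) //= coeffU eqxx mulr1.
by rewrite big1 ?addr0 // => x /negbTE nxy; rewrite coeffU nxy mulr0.
Qed.

Lemma fglift_finE X (M : lmodType int) (f : X -> M) (v : {freeg X}) :
  fglift f v = \sum_x coeff x v *: f x.
Proof.
by rewrite {1}[v]freeg_finE raddf_sum; apply: eq_bigr => x _; rewrite /= liftU.
Qed.

Lemma kl_mat_inj X Y : injective (@kl_mat X Y).
Proof.
move=> f g /matrixP fg; apply/ffunP => x; apply/eqP/freeg_eqP => y.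
by have := fg (enum_rank y) (enum_rank x); rewrite !mxE !enum_rankK.
Qed.

Lemma kl_mat_is_zmod_morphism X Y : zmod_morphism (@kl_mat X Y).
Proof. by move=> f g; apply/matrixP => i j; rewrite !mxE !ffunE coeffB. Qed.
HB.instance Definition _ X Y := GRing.isZmodMorphism.Build (kleisli X Y)
  'M[int]_(#|Y|, #|X|) (@kl_mat X Y) (@kl_mat_is_zmod_morphism X Y).

Lemma kl_mat1 X : kl_mat (kl_id X) = 1%:M.
Proof.
apply/matrixP => i j; rewrite !mxE ffunE coeffU mul1r.
by rewrite (inj_eq enum_val_inj) eq_sym.
Qed.

Lemma kl_matM X Y Z (h : kleisli Y Z) (f : kleisli X Y) :
  kl_mat (kl_comp h f) = kl_mat h *m kl_mat f.
Proof.
apply/matrixP => i j; rewrite !mxE ffunE MZmul_map fglift_finE raddf_sum /=.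
rewrite -sum_enum_val; apply: eq_bigr => k _.
by rewrite coeffZ !mxE mulrC.
Qed.

(* The convolution ring H_Z(X) of Kleisli arrows from the one-point set to
   X x X. *)
Definition HZ X : Type := kleisli unit (X * X)%type.
HB.instance Definition _ X := GRing.Zmodule.copy (HZ X)
  (kleisli unit (X * X)%type).

Definition HZone X : HZ X := [ffun _ => \sum_(x : X) << (x, x) >>].
Definition HZmul X (f g : HZ X) : HZ X :=
  [ffun t => \sum_(i : X) \sum_(q : X)
     << (\sum_(j : X) coeff (i, j) (f t) * coeff (j, q) (g t)) *g (i, q) >>].

Definition Phi X (f : HZ X) : 'M[int]_#|X| :=
  \matrix_(i, j) coeff (enum_val i, enum_val j) (f tt).

Lemma Phi_inj X : injective (@Phi X).
Proof.
move=> f g /matrixP fg; apply/ffunP => -[]; apply/eqP/freeg_eqP => -[x y].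
by have := fg (enum_rank x) (enum_rank y); rewrite !mxE !enum_rankK.
Qed.

Lemma Phi1 X : Phi (HZone X) = 1%:M.
Proof.
apply/matrixP => i j; rewrite !mxE ffunE raddf_sum /=.
rewrite (bigD1 (enum_val i)) //= coeffU xpair_eqE eqxx /= mul1r.
rewrite (inj_eq enum_val_inj) big1 ?addr0 // => x /negbTE nx.
by rewrite coeffU xpair_eqE nx mulr0.
Qed.

Lemma coeff_pair_sum X (A : X -> X -> int) x y :
  coeff (x, y) (\sum_(i : X) \sum_(q : X) << A i q *g (i, q) >>) = A x y.
Proof.
rewrite pair_big raddf_sum (bigD1 (x, y)) //= coeffU eqxx mulr1.
rewrite big1 ?addr0 // => -[i q] /negbTE nxy; by rewrite coeffU nxy mulr0.
Qed.

Lemma PhiM X (f g : HZ X) : Phi (HZmul f g) = Phi f *m Phi g.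
Proof.
apply/matrixP => i q; rewrite !mxE ffunE coeff_pair_sum -sum_enum_val.
by apply: eq_bigr => j _; rewrite !mxE.
Qed.

Lemma Phi_is_zmod_morphism X : zmod_morphism (@Phi X).
Proof. by move=> f g; apply/matrixP => i j; rewrite !mxE !ffunE coeffB. Qed.
HB.instance Definition _ X := GRing.isZmodMorphism.Build (HZ X) 'M[int]_#|X|
  (@Phi X) (@Phi_is_zmod_morphism X).

Section Ring.
Variable X : finType.
Implicit Types f g h : HZ X.

Fact HZmulA : associative (@HZmul X).
Proof. by move=> f g h; apply: Phi_inj; rewrite !PhiM mulmxA. Qed.
Fact HZmul1 : left_id (HZone X) (@HZmul X).
Proof. by move=> f; apply: Phi_inj; rewrite PhiM Phi1 mul1mx. Qed.
Fact HZ1mul : right_id (HZone X) (@HZmul X).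
Proof. by move=> f; apply: Phi_inj; rewrite PhiM Phi1 mulmx1. Qed.
Fact HZmulDl : left_distributive (@HZmul X) +%R.
Proof. by move=> f g h; apply: Phi_inj; rewrite raddfD /= !PhiM raddfD mulmxDl. Qed.
Fact HZmulDr : right_distributive (@HZmul X) +%R.
Proof. by move=> f g h; apply: Phi_inj; rewrite raddfD /= !PhiM raddfD mulmxDr. Qed.

HB.instance Definition _ := GRing.Zmodule_isPzRing.Build (HZ X)
  HZmulA HZmul1 HZ1mul HZmulDl HZmulDr.
End Ring.

Lemma Phi_is_monoid_morphism X : monoid_morphism (@Phi X).
Proof. by split=> [|f g]; [exact: Phi1 | exact: PhiM]. Qed.
HB.instance Definition _ X := GRing.isMonoidMorphism.Build (HZ X) 'M[int]_#|X|
  (@Phi X) (@Phi_is_monoid_morphism X).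

Lemma Phi_bij X : bijective (@Phi X).
Proof.
pose inv (A : 'M[int]_#|X|) : HZ X :=
  [ffun _ => \sum_(x : X) \sum_(y : X) << A (enum_rank x) (enum_rank y) *g (x, y) >>].
suff PhiK : cancel inv (@Phi X).
  by exists inv => // f; apply: Phi_inj; rewrite PhiK.
by move=> A; apply/matrixP => i j; rewrite mxE ffunE coeff_pair_sum !enum_valK.
Qed.
End Kleisli.

Section Klcrep.
Variable R : pzRingType.

Record klcrep := Klcrep {
  carrier : finType;
  rho : {rmorphism R -> HZ carrier}
}.
Implicit Types V W U : klcrep.

Definition intertwiner V W : {pred kleisli (carrier V) (carrier W)} :=
  fun f => `[< forall r : R,
    Phi (rho W r) *m kl_mat f = kl_mat f *m Phi (rho V r) >].
Arguments intertwiner : clear implicits.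

Fact intertwiner_zmod V W : zmod_closed (intertwiner V W).
Proof.
split=> [|f g /asboolP Hf /asboolP Hg]; apply/asboolP => r.
  by rewrite raddf0 mulmx0 mul0mx.
by rewrite raddfB mulmxBr mulmxBl Hf Hg.
Qed.
HB.instance Definition _ V W := GRing.isZmodClosed.Build
  (kleisli (carrier V) (carrier W)) (intertwiner V W) (intertwiner_zmod V W).

Record klcrep_hom V W := KlcrepHom {
  kl_arrow :> kleisli (carrier V) (carrier W);
  kl_arrowP : kl_arrow \in intertwiner V W
}.
HB.instance Definition _ V W := [isSub for @kl_arrow V W].
HB.instance Definition _ V W := [Choice of klcrep_hom V W by <:].
HB.instance Definition _ V W :=
  [SubChoice_isSubZmodule of klcrep_hom V W by <:].

Fact kl_id_intertwiner V : kl_id (carrier V) \in intertwiner V V.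
Proof. by apply/asboolP => r; rewrite kl_mat1 mulmx1 mul1mx. Qed.
Fact kl_comp_intertwiner V W U (g : klcrep_hom W U) (f : klcrep_hom V W) :
  kl_comp g f \in intertwiner V U.
Proof.
apply/asboolP => r; case: g f => [g /asboolP Hg] [f /asboolP Hf] /=.
by rewrite kl_matM mulmxA Hg -mulmxA Hf mulmxA.
Qed.

Definition klcrep_id V : klcrep_hom V V := KlcrepHom (kl_id_intertwiner V).
Definition klcrep_comp V W U (g : klcrep_hom W U) (f : klcrep_hom V W) :
  klcrep_hom V U := KlcrepHom (kl_comp_intertwiner g f).

Lemma klcrep_homP V W (f g : klcrep_hom V W) : kl_mat f = kl_mat g -> f = g.
Proof. by move/kl_mat_inj/val_inj. Qed.

Lemma kl_mat_homD V W (f g : klcrep_hom V W) :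
  kl_mat (kl_arrow (f + g)) = kl_mat f + kl_mat g.
Proof.
by rewrite -raddfD; congr kl_mat; apply: (raddfD val).
Qed.

Fact klcrep_compA V W U T (h : klcrep_hom U T) (g : klcrep_hom W U)
    (f : klcrep_hom V W) :
  klcrep_comp h (klcrep_comp g f) = klcrep_comp (klcrep_comp h g) f.
Proof. by apply: klcrep_homP; rewrite !kl_matM mulmxA. Qed.
Fact klcrep_comp1m V W (f : klcrep_hom V W) : klcrep_comp (klcrep_id W) f = f.
Proof. by apply: klcrep_homP; rewrite kl_matM kl_mat1 mul1mx. Qed.
Fact klcrep_compm1 V W (f : klcrep_hom V W) : klcrep_comp f (klcrep_id V) = f.
Proof. by apply: klcrep_homP; rewrite kl_matM kl_mat1 mulmx1. Qed.
Fact klcrep_compDl V W U (g g' : klcrep_hom W U) (f : klcrep_hom V W) :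
  klcrep_comp (g + g') f = klcrep_comp g f + klcrep_comp g' f.
Proof.
by apply: klcrep_homP; rewrite kl_mat_homD !kl_matM kl_mat_homD mulmxDl.
Qed.
Fact klcrep_compDr V W U (g : klcrep_hom W U) (f f' : klcrep_hom V W) :
  klcrep_comp g (f + f') = klcrep_comp g f + klcrep_comp g f'.
Proof.
by apply: klcrep_homP; rewrite kl_mat_homD !kl_matM kl_mat_homD mulmxDr.
Qed.

Definition Klcrep_cat : preadditive :=
  @Preadditive klcrep klcrep_hom klcrep_id klcrep_comp klcrep_compA
    klcrep_comp1m klcrep_compm1 klcrep_compDl klcrep_compDr.
End Klcrep.

Section Coords.
Variable X : finType.

Definition coords (v : {freeg X}) : 'cV[int]_#|X| :=
  \col_i coeff (enum_val i) v.
Definition of_coords (c : 'cV[int]_#|X|) : {freeg X} :=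
  \sum_i << c i 0 *g enum_val i >>.

Lemma coordsK : cancel coords of_coords.
Proof.
move=> v; rewrite [RHS]freeg_finE -sum_enum_val.
by apply: eq_bigr => i _; rewrite mxE.
Qed.

Lemma of_coordsK : cancel of_coords coords.
Proof.
move=> c; apply/matrixP => i j; rewrite (ord1 j) mxE raddf_sum (bigD1 i) //=.
rewrite coeffU eqxx mulr1 big1 ?addr0 // => k /negbTE nk.
by rewrite coeffU (inj_eq enum_val_inj) nk mulr0.
Qed.

Lemma coords_is_zmod_morphism : zmod_morphism coords.
Proof. by move=> v w; apply/matrixP => i j; rewrite !mxE coeffB. Qed.
HB.instance Definition _ := GRing.isZmodMorphism.Build {freeg X} 'cV[int]_#|X|
  coords coords_is_zmod_morphism.

Lemma coordsD v w : coords (v + w) = coords v + coords w.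
Proof. exact: raddfD. Qed.
End Coords.

Lemma coords_ext (X Y : finType) (f : kleisli X Y) (v : {freeg X}) :
  coords (MZmul (MZmap f v)) = kl_mat f *m coords v.
Proof.
apply/matrixP => i j; rewrite !mxE MZmul_map fglift_finE raddf_sum /=.
rewrite -sum_enum_val; apply: eq_bigr => k _.
by rewrite coeffZ !mxE mulrC.
Qed.

Section FunctorF.
Variable R : pzRingType.
Implicit Types V W U : klcrep R.

(* M_rho = M_Z(X), with r acting by the matrix Phi_X(rho(r)). *)
Definition Mrep V : Type := {freeg (carrier V)}.
HB.instance Definition _ V := GRing.Zmodule.copy (Mrep V) {freeg (carrier V)}.

Section Action.
Variable V : klcrep R.

Definition Mrep_scale (r : R) (v : Mrep V) : Mrep V :=
  of_coords (Phi (rho V r) *m coords v).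

Lemma coords_scale r v : coords (Mrep_scale r v) = Phi (rho V r) *m coords v.
Proof. exact: of_coordsK. Qed.

Let coords_inj := can_inj (@coordsK (carrier V)).

Fact Mrep_scaleA r s v : Mrep_scale r (Mrep_scale s v) = Mrep_scale (r * s) v.
Proof. by apply: coords_inj; rewrite !coords_scale !rmorphM mulmxA. Qed.
Fact Mrep_scale1 : left_id 1 Mrep_scale.
Proof. by move=> v; apply: coords_inj; rewrite coords_scale !rmorph1 mul1mx. Qed.
Fact Mrep_scaleDr : right_distributive Mrep_scale +%R.
Proof.
move=> r v w; apply: coords_inj.
by rewrite coordsD !coords_scale coordsD mulmxDr.
Qed.
Fact Mrep_scaleDl v : {morph Mrep_scale^~ v : r s / r + s}.
Proof.
move=> r s; apply: coords_inj.
by rewrite coordsD !coords_scale !raddfD mulmxDl.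
Qed.

HB.instance Definition _ := GRing.Zmodule_isLmodule.Build R (Mrep V)
  Mrep_scaleA Mrep_scale1 Mrep_scaleDr Mrep_scaleDl.

Lemma Mrep_finitely_generated : finitely_generated (Mrep V).
Proof.
exists #|carrier V|, (fun i => << enum_val i >> : Mrep V) => v.
exists (fun i => (coeff (enum_val i) v)%:~R).
rewrite {1}[v]freeg_finE -sum_enum_val; apply: eq_bigr => i _.
by rewrite scaler_int freegU_mulz intz.
Qed.

Lemma Mrep_free : free_of_finite_rank (Mrep V).
Proof.
exists #|carrier V|, (fun i => << enum_val i >> : Mrep V) => v.
have E (c : 'I_#|carrier V| -> int) :
    \sum_i (<< enum_val i >> : Mrep V) *~ c i = of_coords (\col_i c i).
  by apply: eq_bigr => i _; rewrite mxE freegU_mulz intz.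
exists [ffun i => coeff (enum_val i) v]; split.
  rewrite E -[LHS]coordsK; congr of_coords.
  by apply/matrixP => i j; rewrite !mxE ffunE.
move=> c ->; rewrite E; apply/ffunP => i; rewrite ffunE.
by have /matrixP/(_ i 0) := of_coordsK (\col_i c i); rewrite !mxE.
Qed.
End Action.

(* The additive extension of [x] |-> f(x). *)
Definition Mrep_map V W (f : klcrep_hom V W) (v : Mrep V) : Mrep W :=
  MZmul (MZmap (kl_arrow f) v).

Fact Mrep_map_linear V W (f : klcrep_hom V W) : linear (Mrep_map f).
Proof.
have coords_inj := can_inj (@coordsK (carrier W)).
move=> r v w; apply: coords_inj; rewrite coordsD coords_scale !coords_ext.
have /asboolP Hf := kl_arrowP f.
by rewrite coordsD coords_scale mulmxDr !mulmxA Hf.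
Qed.
HB.instance Definition _ V W (f : klcrep_hom V W) :=
  GRing.isLinear.Build R (Mrep V) (Mrep W) _ (Mrep_map f) (Mrep_map_linear f).

Definition F_ob V : R_free R :=
  exist _ (Mrep V : lmodType R)
    (conj (Mrep_finitely_generated V) (Mrep_free V)).

Definition F_mor V W (f : klcrep_hom V W) : linhom (Mrep V) (Mrep W) :=
  (Mrep_map f : {linear Mrep V -> Mrep W}).

Fact F_mor1 V : F_mor (klcrep_id V) = linhom_id (Mrep V).
Proof.
apply: linhomP => v; apply: (can_inj (@coordsK (carrier V))).
by rewrite coords_ext kl_mat1 mul1mx.
Qed.

Fact F_morM V W U (g : klcrep_hom W U) (f : klcrep_hom V W) :
  F_mor (klcrep_comp g f) = linhom_comp (F_mor g) (F_mor f).
Proof.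
apply: linhomP => v; apply: (can_inj (@coordsK (carrier U))).
by rewrite /= !coords_ext kl_matM mulmxA.
Qed.

Definition F_R : functor (Klcrep_cat R) (R_free R) :=
  @Functor (Klcrep_cat R) (R_free R) F_ob F_mor F_mor1 F_morM.
End FunctorF.

(* A right R-module is a left module over the converse ring R^c, with
   n . r = (r : R^c) *: n.  The tensor product is the quotient of the free
   Abelian group on N x M by the subgroup generated by the usual relations. *)
Section Tensor.
Variable R : pzRingType.

Section TensorGroup.
Variables (N : lmodType R^c) (M : lmodType R).

Inductive tensor_rel : {freeg (N * M)%type} -> Prop :=
| tensor_rel_addl n n' m :
    tensor_rel (<< (n + n', m) >> - << (n, m) >> - << (n', m) >>)
| tensor_rel_addr n m m' :
    tensor_rel (<< (n, m + m') >> - << (n, m) >> - << (n, m') >>)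
| tensor_rel_balanced n (r : R) m :
    tensor_rel (<< ((r : R^c) *: n, m) >> - << (n, r *: m) >>)
| tensor_rel0 : tensor_rel 0
| tensor_relB u v : tensor_rel u -> tensor_rel v -> tensor_rel (u - v).

Definition tensor_sub : {pred {freeg (N * M)%type}} :=
  fun u => `[< tensor_rel u >].

Fact tensor_sub_zmod : zmod_closed tensor_sub.
Proof.
split=> [|u v /asboolP Hu /asboolP Hv]; apply/asboolP.
  exact: tensor_rel0.
exact: tensor_relB.
Qed.
HB.instance Definition _ := GRing.isZmodClosed.Build {freeg (N * M)%type}
  tensor_sub tensor_sub_zmod.

Definition tensor : zmodType := Quotient.quot tensor_sub.

Definition tensor_pi (u : {freeg (N * M)%type}) : tensor :=
  \pi_(Quotient.quot tensor_sub) u.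
Definition tensor_repr (t : tensor) : {freeg (N * M)%type} :=
  repr (t : Quotient.quot tensor_sub).

Fact tensor_piP u v : tensor_pi u = tensor_pi v <-> tensor_rel (u - v).
Proof.
have /= E := Quotient.idealrBE tensor_sub u v.
by split=> [/eqP|/asboolP H]; [rewrite -E => /asboolP | apply/eqP; rewrite -E].
Qed.

Fact tensor_reprK : cancel tensor_repr tensor_pi.
Proof. exact: reprK. Qed.
End TensorGroup.

(* The map f (x) 1_M induced by a homomorphism f of right modules. *)
Definition tensor_map (N' N : lmodType R^c) (M : lmodType R)
    (f : {linear N' -> N}) (t : tensor N' M) : tensor N M :=
  tensor_pi (MZmap (fun p : N' * M => (f p.1, p.2)) (tensor_repr t)).

Fact tensor_map_pi (N' N : lmodType R^c) (M : lmodType R)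
    (f : {linear N' -> N}) (u : {freeg (N' * M)%type}) :
  tensor_map f (tensor_pi u) =
  tensor_pi (MZmap (fun p : N' * M => (f p.1, p.2)) u).
Proof.
rewrite /tensor_map; set h := fun p : N' * M => _.
have hB v w : MZmap h (v - w) = MZmap h v - MZmap h w by exact: raddfB.
have hU p : MZmap h << p >> = << h p >> by exact: fglift_unit.
have hrel v : tensor_rel v -> tensor_rel (MZmap h v).
  elim=> [n n' m|n m m'|n r m||v1 v2 _ IH1 _ IH2]; rewrite ?hB ?hU /h /=.
  - by rewrite linearD; apply: tensor_rel_addl.
  - exact: tensor_rel_addr.
  - by rewrite linearZ; apply: tensor_rel_balanced.
  - by rewrite /MZmap raddf0; apply: tensor_rel0.
  - exact: tensor_relB.
by apply/tensor_piP; rewrite -hB; apply/hrel/tensor_piP; rewrite tensor_reprK.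
Qed.

(* The functor - (x)_R M preserves injective homomorphisms of right modules. *)
Definition flat (M : lmodType R) : Prop :=
  forall (N' N : lmodType R^c) (f : {linear N' -> N}),
    injective f -> injective (@tensor_map N' N M f).

Definition flat_rep (V : klcrep R) : Prop := flat (Mrep V).

Definition flat_free (M : R_free R) : Prop := flat (proj1_sig M).

Definition Klcrep_flat : preadditive := @full_subcat (Klcrep_cat R) flat_rep.

Definition R_free_flat : preadditive := full_subcat flat_free.
End Tensor.

(* Main.v *)
From HB Require Import structures.
Require Import Defs.
From mathcomp Require Import all_boot all_order all_algebra.
From mathcomp Require Import freeg boolp.
Import Defs.

(** Choosing a Z-basis of a module whose additive group is free of finite rank
    turns the action of each scalar into an integral matrix, and turns linear
    maps into matrices intertwining those actions.  Thus [F_R] is full and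
    faithful (a linear map out of the free group on X is determined by, and may
    be prescribed by, its values on X, and linearity over R is precisely the
    intertwining condition), and it is essentially surjective: if e is a Z-basis
    of M indexed by X, the matrices of the scalars in the basis e give a ring
    homomorphism from R to the convolution ring of X, multiplicativity being
    forced by the uniqueness of coordinates ([F_R_full], [F_R_faithful],
    [F_R_ess_surj]).  A full, faithful and essentially surjective functor is an
    equivalence by choice of preimages ([ff_ess_surj_equivalence]).

    Additivity of the categories need only be checked on the module side: zero
    objects and biproducts are transported back along a fully faithful,
    essentially surjective additive functor
    ([additive_category_of_ff_ess_surj]).  For R-free modules they are the zero
    module and the direct product, the union of two bases being a basis.

    A Kleisli representation is flat exactly when its image under [F_R] is flat,
    so the restricted functor is again full and faithful.  It remains to know
    that flatness is invariant under isomorphism and is inherited by zero objects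
    and biproducts.  These are three instances of [flat_decomposition]: if the
    identity of P is a finite sum of maps factoring through flat modules, then P
    is flat.  The reason is that N (x) - is a functor sending this decomposition
    to one of the identity of N (x) P, naturally in N, so an element t of
    N' (x) P is recovered from its components in the N' (x) M_k, and these are
    determined by (f (x) 1) t when f is injective and every M_k is flat. *)

Set Implicit Arguments.
Unset Strict Implicit.
Unset Printing Implicit Defensive.

Import GRing.Theory.
Local Open Scope ring_scope.

(** * Preadditive categories *)

Section Preadditive.
Variable C : preadditive.

Lemma comp0m (X Y Z : C) (f : hom X Y) : comp (0 : hom Y Z) f = 0.
Proof. by apply: (addrI (comp 0 f)); rewrite -compDl !addr0. Qed.

Lemma compm0 (X Y Z : C) (g : hom Y Z) : comp g (0 : hom X Y) = 0.
Proof. by apply: (addrI (comp g 0)); rewrite -compDr !addr0. Qed.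

Lemma full_subcat_additive (P : C -> Prop) :
  (exists2 Z : C, is_zero_object Z & P Z) ->
  (forall X Y, P X -> P Y ->
     exists S i1 i2 p1 p2, @is_biproduct C X Y S i1 i2 p1 p2 /\ P S) ->
  is_additive_category (full_subcat P).
Proof.
move=> [Z zZ PZ] biprod; split.
  by exists (exist P Z PZ) => -[X PX]; apply: zZ.
move=> [X PX] [Y PY].
have [S [i1 [i2 [p1 [p2 [bi PS]]]]]] := biprod X Y PX PY.
by exists (exist P S PS), i1, i2, p1, p2.
Qed.

End Preadditive.

(** * Fully faithful and essentially surjective functors *)

Section Functors.
Variables (C D : preadditive) (F : functor C D).

Definition full : Prop :=
  forall (X Y : C) (g : hom (F X) (F Y)), exists f : hom X Y, fmor F f = g.

Definition faithful : Prop := forall X Y : C, injective (@fmor C D F X Y).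

Definition ess_surj : Prop :=
  forall Y : D, exists (X : C) (e : hom (F X) Y), is_iso e.

Hypotheses (fullF : full) (faithfulF : faithful) (ess_surjF : ess_surj).

(** The quasi-inverse sends Y to a chosen X with F X isomorphic to Y, and is
    defined on morphisms by conjugating with the chosen isomorphisms and taking
    preimages; both functor laws can be checked after applying F. *)
Lemma ff_ess_surj_equivalence : is_equivalence F.
Proof.
have pre_ex : forall XY : C * C,
    exists p : hom (F XY.1) (F XY.2) -> hom XY.1 XY.2, cancel p (@fmor C D F _ _).
  by move=> [X Y]; have [p pK] := choice (fullF (X := X) (Y := Y)); exists p.
pose pre (X Y : C) (g : hom (F X) (F Y)) : hom X Y :=
  projT1 (cid (pre_ex (X, Y))) g.
have preK X Y (g : hom (F X) (F Y)) : fmor F (pre X Y g) = g.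
  exact: (projT2 (cid (pre_ex (X, Y)))).
pose data (Y : D) := {X : C & {e : hom (F X) Y & {d : hom Y (F X) |
                        comp d e = idm _ /\ comp e d = idm _}}}.
have inhab Y : data Y.
  case/cid: (ess_surjF Y) => X /cid[e] /cid[d de].
  by exists X, e, d.
pose G0 Y := projT1 (inhab Y).
pose e Y : hom (F (G0 Y)) Y := projT1 (projT2 (inhab Y)).
pose d Y : hom Y (F (G0 Y)) := sval (projT2 (projT2 (inhab Y))).
have de Y : comp (d Y) (e Y) = idm _.
  exact: (svalP (projT2 (projT2 (inhab Y)))).1.
have ed Y : comp (e Y) (d Y) = idm _.
  exact: (svalP (projT2 (projT2 (inhab Y)))).2.
(* Only the equations [de] and [ed] matter from here on. *)
clearbody G0 e d.
pose G1 (Y Z : D) (g : hom Y Z) : hom (G0 Y) (G0 Z) :=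
  pre _ _ (comp (d Z) (comp g (e Y))).
have FG1 Y Z (g : hom Y Z) : fmor F (G1 Y Z g) = comp (d Z) (comp g (e Y)).
  exact: preK.
have G11 Y : G1 Y Y (idm Y) = idm (G0 Y).
  by apply: faithfulF; rewrite FG1 fmor1 comp1m.
have G1M X Y Z (g : hom Y Z) (f : hom X Y) :
    G1 X Z (comp g f) = comp (G1 Y Z g) (G1 X Y f).
  by apply: faithfulF; rewrite fmorM !FG1 -!compA (compA (e Y)) ed comp1m.
exists (@Functor D C G0 G1 G11 G1M); split.
  exists (fun X : C => pre (G0 (F X)) X (e (F X))); split=> [X Y f|X] /=.
    by apply: faithfulF; rewrite !fmorM FG1 !preK compA ed comp1m.
  exists (pre X (G0 (F X)) (d (F X))).
  by split; apply: faithfulF; rewrite fmorM !preK fmor1.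
exists e; split=> [X Y f|X] /=; first by rewrite FG1 compA ed comp1m.
by exists (d X).
Qed.

Hypothesis additiveF : is_additive_functor F.

Lemma fmor0 (X Y : C) : fmor F (0 : hom X Y) = 0.
Proof. by apply: (addrI (fmor F 0)); rewrite -additiveF !addr0. Qed.

(** The equations defining zero objects and biproducts are reflected by F.  A
    biproduct S of F X and F Y in D is moved to F P along an isomorphism, and its
    structure maps then have preimages under F. *)
Lemma additive_category_of_ff_ess_surj :
  is_additive_category D -> is_additive_category C.
Proof.
move=> [[Z zeroZ] biprod]; split.
  have [X [e [d [de _]]]] := ess_surjF Z; exists X => Y.
  split=> f; apply: faithfulF; rewrite fmor0.
    by rewrite -(comp1m (fmor F f)) -de -compA
      ((zeroZ (F Y)).1 (comp e _)) compm0.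
  by rewrite -(compm1 (fmor F f)) -de compA ((zeroZ (F Y)).2 (comp _ d)) comp0m.
move=> X Y; have [S [i1 [i2 [p1 [p2 [p11 p22 p12 p21 idS]]]]]] :=
  biprod (F X) (F Y).
have [P [e [d [de ed]]]] := ess_surjF S.
have [j1 Fj1] := fullF (comp d i1); have [j2 Fj2] := fullF (comp d i2).
have [q1 Fq1] := fullF (comp p1 e); have [q2 Fq2] := fullF (comp p2 e).
have pi_de U V (p : hom S U) (i : hom V S) :
    comp (comp p e) (comp d i) = comp p i.
  by rewrite -compA (compA e) ed comp1m.
exists P, j1, j2, q1, q2.
split; apply: faithfulF; rewrite ?additiveF !fmorM ?fmor1 ?fmor0
  ?Fq1 ?Fq2 ?Fj1 ?Fj2 ?pi_de //.
by rewrite -!compA -compDr (compA i1) (compA i2) -compDl idS comp1m.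
Qed.

Lemma ff_ess_surj_additive_equivalence :
  is_additive_category D -> is_additive_equivalence F.
Proof.
move=> addD; split=> //; last exact: ff_ess_surj_equivalence.
exact: additive_category_of_ff_ess_surj.
Qed.

End Functors.

Lemma restrict_ess_surj (C D : preadditive) (F : functor C D)
    (P : C -> Prop) (Q : D -> Prop) (PQ : forall X, P X -> Q (F X)) :
  (forall X, Q (F X) -> P X) ->
  (forall (X Y : D) (f : hom X Y), is_iso f -> Q Y -> Q X) ->
  ess_surj F -> ess_surj (restrict_functor PQ).
Proof.
move=> QP isoQ esF [Y QY]; have [X [e eiso]] := esF Y.
by exists (exist P X (QP _ (isoQ _ _ e eiso QY))), e.
Qed.

(** * Functoriality of the tensor product in the left module, and flatness *)

Section Flat.
Variable R : pzRingType.

Lemma tensor_piB (N : lmodType R^c) (M : lmodType R)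
    (u v : {freeg (N * M)%type}) :
  tensor_pi (u - v) = tensor_pi u - tensor_pi v.
Proof. exact: raddfB. Qed.

Lemma tensor_pi0 (N : lmodType R^c) (M : lmodType R) :
  tensor_pi (0 : {freeg (N * M)%type}) = 0.
Proof. by rewrite -[0 in LHS]subr0 tensor_piB subrr. Qed.

Lemma tensor_pi_addr (N : lmodType R^c) (M : lmodType R)
    (n : N) (m m' : M) :
  tensor_pi << (n, m + m') >> =
    tensor_pi << (n, m) >> + tensor_pi << (n, m') >>.
Proof.
apply/eqP; rewrite -subr_eq0 opprD addrA -!tensor_piB -(tensor_pi0 N M).
by apply/eqP/tensor_piP; rewrite subr0; apply: tensor_rel_addr.
Qed.

Lemma tensor_pi_sumr (N : lmodType R^c) (M : lmodType R) (I : finType)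
    (n : N) (m : I -> M) :
  tensor_pi << (n, \sum_k m k) >> = \sum_k tensor_pi << (n, m k) >>.
Proof.
apply: (big_morph (fun m : M => tensor_pi << (n, m) >>)) => [m1 m2|].
  exact: tensor_pi_addr.
by apply: (addrI (tensor_pi << (n, 0) >>)); rewrite -tensor_pi_addr !addr0.
Qed.

Lemma freeg_indB (K : choiceType) (P : {freeg K} -> Prop) :
  (forall x, P << x >>) -> P 0 -> (forall u v, P u -> P v -> P (u - v)) ->
  forall u, P u.
Proof.
move=> PU P0 PB; have PN u : P u -> P (- u) by rewrite -sub0r; apply: PB.
have PD u v : P u -> P v -> P (u + v).
  by move=> Pu /PN; rewrite -{2}[v]opprK; apply: PB.
move=> u; rewrite -[u]freeg_sumE; elim/big_ind: _ => // x _.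
rewrite -[coeff x u]intz -freegU_mulz; case: (coeff x u) => n.
  by rewrite -pmulrn; elim: n => [|n IHn]; rewrite ?mulr0n ?mulrS //; apply: PD.
rewrite NegzE mulrNz -pmulrn; apply: PN.
by elim: n => [|n IHn]; rewrite ?mulr1n // mulrS; apply: PD.
Qed.

Section MapRight.
Variables (N : lmodType R^c) (M M' : lmodType R) (g : {linear M -> M'}).

Definition map_snd (u : {freeg (N * M)%type}) : {freeg (N * M')%type} :=
  MZmap (fun p : N * M => (p.1, g p.2)) u.

Lemma map_sndB u v : map_snd (u - v) = map_snd u - map_snd v.
Proof. exact: raddfB. Qed.

Lemma map_snd_unit p : map_snd << p >> = << (p.1, g p.2) >>.
Proof. exact: fglift_unit. Qed.

(** The map 1_N (x) g, the companion in the other variable of f (x) 1_M. *)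
Definition tensor_mapr (t : tensor N M) : tensor N M' :=
  tensor_pi (map_snd (tensor_repr t)).

Lemma tensor_mapr_pi u : tensor_mapr (tensor_pi u) = tensor_pi (map_snd u).
Proof.
have hrel v : tensor_rel v -> tensor_rel (map_snd v).
  elim=> [n n' m|n m m'|n r m||v1 v2 _ IH1 _ IH2];
    rewrite ?map_sndB ?map_snd_unit /=.
  - exact: tensor_rel_addl.
  - by rewrite linearD; apply: tensor_rel_addr.
  - by rewrite linearZ; apply: tensor_rel_balanced.
  - by rewrite -[0]subr0 map_sndB subrr; apply: tensor_rel0.
  - exact: tensor_relB.
apply/tensor_piP; rewrite -map_sndB; apply/hrel/tensor_piP.
exact: tensor_reprK.
Qed.

Lemma tensor_mapr_unit n m :
  tensor_mapr (tensor_pi << (n, m) >>) = tensor_pi << (n, g m) >>.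
Proof. by rewrite tensor_mapr_pi map_snd_unit. Qed.

Lemma tensor_maprB t t' : tensor_mapr (t - t') = tensor_mapr t - tensor_mapr t'.
Proof.
rewrite -(tensor_reprK t) -(tensor_reprK t') -tensor_piB !tensor_mapr_pi.
by rewrite map_sndB tensor_piB.
Qed.

End MapRight.

Lemma tensor_mapB (N' N : lmodType R^c) (M : lmodType R) (f : {linear N' -> N})
    (t t' : tensor N' M) :
  tensor_map f (t - t') = tensor_map f t - tensor_map f t'.
Proof.
rewrite -(tensor_reprK t) -(tensor_reprK t') -tensor_piB !tensor_map_pi.
by rewrite -tensor_piB; congr tensor_pi; exact: raddfB.
Qed.

Lemma tensor_map_unit (N' N : lmodType R^c) (M : lmodType R)
    (f : {linear N' -> N}) n m :
  tensor_map f (tensor_pi (<< (n, m) >> : {freeg (N' * M)%type})) =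
  tensor_pi << (f n, m) >>.
Proof. by rewrite tensor_map_pi; congr tensor_pi; exact: fglift_unit. Qed.

(** Identities between additive maps out of a tensor product are checked on pure
    tensors with this; closure under subtraction alone covers zero and
    opposites. *)
Lemma tensor_indB (N : lmodType R^c) (M : lmodType R) (P : tensor N M -> Prop) :
  (forall n m, P (tensor_pi << (n, m) >>)) ->
  (forall t t', P t -> P t' -> P (t - t')) -> forall t, P t.
Proof.
move=> PU PB t; rewrite -(tensor_reprK t).
elim/freeg_indB: (tensor_repr t) => [[n m]||u v Pu Pv] //.
  by rewrite -(subrr << (0, 0) >>) tensor_piB; apply: PB.
by rewrite tensor_piB; apply: PB.
Qed.

Lemma tensor_map_mapr (N' N : lmodType R^c) (M M' : lmodType R)
    (f : {linear N' -> N}) (g : {linear M -> M'}) (t : tensor N' M) :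
  tensor_map f (tensor_mapr g t) = tensor_mapr g (tensor_map f t).
Proof.
elim/tensor_indB: t => [n m|t t' IHt IHt'].
  by rewrite tensor_mapr_unit !tensor_map_unit tensor_mapr_unit.
by rewrite tensor_maprB !tensor_mapB IHt IHt' tensor_maprB.
Qed.

(** The finite sum of the i_k p_k is the identity of P, hence
    t = sum_k (1 (x) i_k) (1 (x) p_k) t for t in N' (x) P; the components
    (1 (x) p_k) t lie in N' (x) M_k, where f (x) 1 is injective.  The empty
    family gives zero objects, one-element families retracts, and two-element
    families biproducts. *)
Lemma flat_decomposition (I : finType) (M : I -> lmodType R) (P : lmodType R)
    (i : forall k, {linear M k -> P}) (p : forall k, {linear P -> M k}) :
  (forall v, v = \sum_k i k (p k v)) -> (forall k, flat (M k)) -> flat P.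
Proof.
move=> idP flatM N' N f injf.
have idT (t : tensor N' P) : t = \sum_k tensor_mapr (i k) (tensor_mapr (p k) t).
  elim/tensor_indB: t => [n m|t t' IHt IHt'].
    rewrite {1}[m]idP tensor_pi_sumr.
    by apply: eq_bigr => k _; rewrite !tensor_mapr_unit.
  rewrite {1}IHt {1}IHt' -sumrB.
  by apply: eq_bigr => k _; rewrite !tensor_maprB.
move=> t t' ftt'; rewrite (idT t) (idT t'); apply: eq_bigr => k _.
congr (tensor_mapr _ _); apply: (flatM k _ _ f injf).
by rewrite !tensor_map_mapr ftt'.
Qed.

Lemma flat_zero (Z : modcat R) : idm Z = 0 -> flat Z.
Proof.
move=> idZ.
pose S (k : void) : lmodType R := match k with end.
pose i k : {linear S k -> Z} := match k with end.
pose p k : {linear Z -> S k} := match k with end.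
apply: (@flat_decomposition void S Z i p) => [v|[]].
rewrite big1 => [|[]] //.
by have /= := congr1 (fun h : linhom Z Z => h v) idZ.
Qed.

Lemma flat_iso (M N : modcat R) (f : hom M N) : is_iso f -> flat N -> flat M.
Proof.
move=> [g [gf _]] flatN.
apply: (@flat_decomposition unit (fun=> N) M (fun=> g) (fun=> f)) => // v.
rewrite (big_pred1 tt) => [|[]] //.
by have /= -> := congr1 (fun h : linhom M M => h v) gf.
Qed.

Lemma flat_biproduct (M N P : modcat R) i1 i2 p1 p2 :
  @is_biproduct (modcat R) M N P i1 i2 p1 p2 -> flat M -> flat N -> flat P.
Proof.
move=> [_ _ _ _ idP] flatM flatN.
pose S (b : bool) : lmodType R := if b then M else N.
pose i b : {linear S b -> P} := if b is true then i1 else i2.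
pose p b : {linear P -> S b} := if b is true then p1 else p2.
apply: (@flat_decomposition bool S P i p) => [v|[]] //.
rewrite big_bool /=.
by have /= -> := congr1 (fun h : linhom P P => h v) idP.
Qed.

End Flat.

(** * Zero objects and biproducts of modules *)

Section ModuleCat.
Variable R : pzRingType.

Lemma modcat_zero : @is_zero_object (modcat R) 'rV[R]_0.
Proof.
move=> M; split=> f; apply: linhomP => v; first by rewrite [LHS]thinmx0.
by rewrite [v]thinmx0 linear0.
Qed.

Lemma rV0_finitely_generated : finitely_generated 'rV[R]_0.
Proof.
exists 0%N, (fun=> 0) => v; exists (fun=> 0).
by rewrite big_ord0; apply: thinmx0.
Qed.

Lemma rV0_free : free_of_finite_rank 'rV[R]_0.
Proof.
exists 0%N, (fun=> 0) => v; exists [ffun=> 0]; split.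
  by rewrite big_ord0; apply: thinmx0.
by move=> c _; apply/ffunP => -[].
Qed.

Section ProductFamily.
Variables (A B : zmodType) (m n : nat) (e : 'I_m -> A) (d : 'I_n -> B).

Definition prod_family (k : 'I_(m + n)) : A * B :=
  match split k with inl i => (e i, 0) | inr j => (0, d j) end.

Lemma prod_family_lshift i : prod_family (lshift n i) = (e i, 0).
Proof. by rewrite /prod_family (unsplitK (inl i)). Qed.

Lemma prod_family_rshift j : prod_family (rshift m j) = (0, d j).
Proof. by rewrite /prod_family (unsplitK (inr j)). Qed.

(** The operators [F k] are left abstract so as to cover multiplication by
    scalars of R and by integers at once. *)
Lemma sum_prod_family (F : 'I_(m + n) -> A * B -> A * B)
    (Fl : 'I_m -> A -> A) (Fr : 'I_n -> B -> B) :
  (forall i v, F (lshift n i) (v, 0) = (Fl i v, 0)) ->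
  (forall j w, F (rshift m j) (0, w) = (0, Fr j w)) ->
  \sum_k F k (prod_family k) = (\sum_i Fl i (e i), \sum_j Fr j (d j)).
Proof.
move=> FlE FrE; rewrite big_split_ord /=.
under eq_bigr => i _ do rewrite prod_family_lshift FlE.
under [X in _ + X]eq_bigr => j _ do rewrite prod_family_rshift FrE.
apply: injective_projections => /=; rewrite !raddf_sum /=.
  by rewrite [X in _ + X]big1 ?addr0.
by rewrite [X in X + _]big1 ?add0r.
Qed.

End ProductFamily.

Lemma prod_finitely_generated (M N : lmodType R) :
  finitely_generated M -> finitely_generated N ->
  finitely_generated (M * N)%type.
Proof.
move=> [m [e eP]] [n [d dP]].
exists (m + n)%N, (prod_family e d) => -[v w].
have [a ->] := eP v; have [b ->] := dP w.
pose c k := match split k with inl i => a i | inr j => b j end.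
exists c.
rewrite (sum_prod_family e d (F := fun k => *:%R (c k)) (Fl := fun i => *:%R (a i))
  (Fr := fun j => *:%R (b j))) // => [i v'|j w']; rewrite /c.
  by rewrite (unsplitK (inl i)); congr (_, _); rewrite scaler0.
by rewrite (unsplitK (inr j)); congr (_, _); rewrite scaler0.
Qed.

(** The union of two bases is a basis: coordinates with respect to it are pairs
    of coordinates. *)
Lemma prod_free (A B : zmodType) :
  free_of_finite_rank A -> free_of_finite_rank B ->
  free_of_finite_rank (A * B)%type.
Proof.
move=> [m [e eP]] [n [d dP]].
have edE (c : {ffun 'I_(m + n) -> int}) :
    \sum_k prod_family e d k *~ c k =
    (\sum_i e i *~ c (lshift n i), \sum_j d j *~ c (rshift m j)).
  apply: (sum_prod_family e d (F := fun k x => x *~ c k)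
    (Fl := fun i v => v *~ c (lshift n i)) (Fr := fun j w => w *~ c (rshift m j)))
    => [i v|j w]; apply: injective_projections;
    by rewrite ?(raddfMz fst) ?(raddfMz snd) /= ?mul0rz.
exists (m + n)%N, (prod_family e d) => -[v w].
have [a [va aU]] := eP v; have [b [wb bU]] := dP w.
exists [ffun k => match split k with inl i => a i | inr j => b j end]; split.
  rewrite edE va wb; congr (_, _); apply: eq_bigr => i _; rewrite ffunE.
    by rewrite (unsplitK (inl i)).
  by rewrite (unsplitK (inr i)).
move=> c; rewrite edE => -[vE wE].
have aE : a = [ffun i => c (lshift n i)].
  by apply: aU; rewrite vE; apply: eq_bigr => i _; rewrite ffunE.
have bE : b = [ffun j => c (rshift m j)].
  by apply: bU; rewrite wE; apply: eq_bigr => i _; rewrite ffunE.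
apply/ffunP => k; rewrite ffunE aE bE -[k in RHS]splitK.
by case: (split k) => i; rewrite ffunE.
Qed.

Section Biproduct.
Variables M N : lmodType R.

Definition inl_mod (v : M) : M * N := (v, 0).
Definition inr_mod (w : N) : M * N := (0, w).

Fact inl_mod_linear : linear inl_mod.
Proof.
by move=> r v w; apply: injective_projections; rewrite //= scaler0 addr0.
Qed.

Fact inr_mod_linear : linear inr_mod.
Proof.
by move=> r v w; apply: injective_projections; rewrite //= scaler0 addr0.
Qed.
HB.instance Definition _ :=
  GRing.isLinear.Build R M (M * N)%type _ inl_mod inl_mod_linear.
HB.instance Definition _ :=
  GRing.isLinear.Build R N (M * N)%type _ inr_mod inr_mod_linear.

Lemma modcat_biproduct :
  @is_biproduct (modcat R) M N (M * N)%type
    (inl_mod : {linear M -> (M * N)%type})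
    (inr_mod : {linear N -> (M * N)%type})
    (fst : {linear (M * N)%type -> M}) (snd : {linear (M * N)%type -> N}).
Proof.
split; apply: linhomP => //= -[v w].
by apply: injective_projections; rewrite /= ?addr0 ?add0r.
Qed.

End Biproduct.
End ModuleCat.

(** * The functor from Kleisli representations to modules *)

Section FunctorF.
Variable R : pzRingType.

Lemma mulmx_ext (m n : nat) (A B : 'M[int]_(m, n)) :
  (forall c : 'cV[int]_n, A *m c = B *m c) -> A = B.
Proof.
move=> AB; apply/matrixP => i j.
by have /matrixP/(_ i 0) := AB (delta_mx j 0); rewrite -!colE !mxE.
Qed.

Lemma F_R_additive : is_additive_functor (F_R R).
Proof.
move=> V W f g; apply: linhomP => v; apply: (can_inj (@coordsK _)).
by rewrite coords_ext /= kl_mat_homD mulmxDl -!coords_ext -coordsD.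
Qed.

Lemma F_R_faithful : faithful (F_R R).
Proof.
move=> V W f g fg; apply: klcrep_homP; apply: mulmx_ext => c.
rewrite -[c]of_coordsK -!coords_ext; congr coords.
exact: (congr1 (fun h : linhom (Mrep V) (Mrep W) => h (of_coords c)) fg).
Qed.

(** A linear map is the additive extension of its values on the generators; its
    linearity, tested on all coordinate vectors, is the intertwining relation. *)
Lemma F_R_full : full (F_R R).
Proof.
move=> V W g.
pose g' : {linear Mrep V -> Mrep W} := g.
pose f : kleisli (carrier V) (carrier W) := [ffun x => g' << x >>].
have gE v : g' v = MZmul (MZmap f v).
  rewrite MZmul_map.
  pose ga : {additive {freeg (carrier V)} -> {freeg (carrier W)}} := g'.
  apply: (@freeg_ext _ _ ga (fglift f)) => x /=.
  by rewrite fglift_unit ffunE.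
have fP : f \in @intertwiner R V W.
  apply/asboolP => r; apply: mulmx_ext => c.
  rewrite -!mulmxA -[c]of_coordsK -coords_scale -!coords_ext -!gE linearZ.
  by rewrite coords_scale.
by exists (KlcrepHom fP); apply: linhomP => v; rewrite [RHS]gE.
Qed.

Section EssSurj.
Variables (M : lmodType R) (X : finType) (e : 'I_#|X| -> M).
Hypothesis eP : forall v,
  exists! c : {ffun 'I_#|X| -> int}, v = \sum_i e i *~ c i.

Definition combine (c : 'cV[int]_#|X|) : M := \sum_i e i *~ c i 0.

Lemma combineB : zmod_morphism combine.
Proof.
move=> c d; rewrite /combine -sumrB; apply: eq_bigr => i _.
by rewrite !mxE mulrzBr.
Qed.
HB.instance Definition _ := GRing.isZmodMorphism.Build _ M combine combineB.

Lemma combine_inj : injective combine.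
Proof.
have ffE c : combine c = \sum_i e i *~ [ffun i => c i 0] i.
  by apply: eq_bigr => i _; rewrite ffunE.
move=> c d cd; have [a [_ aU]] := eP (combine c).
have ac := aU _ (ffE c); have ad := aU [ffun i => d i 0].
rewrite -ffE in ad; have {ad} := ad cd; rewrite ac => /ffunP cdE.
by apply/matrixP => i j; rewrite (ord1 j); have := cdE i; rewrite !ffunE.
Qed.

Lemma combine_surj v : exists c, combine c = v.
Proof.
have [a [-> _]] := eP v; exists (\col_i a i).
by apply: eq_bigr => i _; rewrite mxE.
Qed.

Lemma combine_mulmx n (A : 'M[int]_(#|X|, n)) (c : 'cV[int]_n) :
  combine (A *m c) = \sum_j combine (col j A) *~ c j 0.
Proof.
have -> : A *m c = \sum_j c j 0 *: col j A.
  apply/matrixP => i k; rewrite (ord1 k) !mxE summxE.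
  by apply: eq_bigr => j _; rewrite !mxE mulrC.
rewrite raddf_sum; apply: eq_bigr => j _.
by rewrite -[c j 0]intz scaler_int raddfMz intz.
Qed.

Lemma action_matrix_ex r :
  exists A : 'M[int]_#|X|, forall c, combine (A *m c) = r *: combine c.
Proof.
have [a aP] := choice (fun j => combine_surj (r *: e j)).
(* Column j lists the coordinates of r e_j. *)
exists (\matrix_(i, j) a j i 0) => c.
rewrite combine_mulmx /combine scaler_sumr; apply: eq_bigr => j _.
rewrite -scalerMzr -aP; congr (combine _ *~ _).
by apply/matrixP => i k; rewrite (ord1 k) !mxE.
Qed.

(** Since coordinates are unique, a square matrix A is determined by the map
    c |-> combine (A c).  Hence the matrices of r - s, rs and 1 are those that
    the module axioms predict, and r |-> matrix of r is a ring homomorphism;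
    inverting [Phi] moves it to the convolution ring. *)
Lemma representation_ex : exists rho : {rmorphism R -> HZ X},
  forall r c, combine (Phi (rho r) *m c) = r *: combine c.
Proof.
have [A AP] := choice action_matrix_ex.
have [inv PhiK invK] := Phi_bij X.
pose rho r := inv (A r).
have rhoP r c : combine (Phi (rho r) *m c) = r *: combine c by rewrite invK AP.
have rho_ext f g :
    (forall c, combine (Phi f *m c) = combine (Phi g *m c)) -> f = g.
  by move=> fg; apply: Phi_inj; apply: mulmx_ext => c; apply: combine_inj.
have rhoB : zmod_morphism rho.
  move=> r s; apply: rho_ext => c.
  by rewrite raddfB /= mulmxBl raddfB /= !rhoP scalerBl.
have rhoM : monoid_morphism rho.
  split=> [|r s]; apply: rho_ext => c; rewrite rhoP.
    by rewrite Phi1 mul1mx scale1r.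
  by rewrite PhiM -mulmxA !rhoP scalerA.
pose rhoA := GRing.isZmodMorphism.Build R (HZ X) rho rhoB.
pose rhoR := GRing.isMonoidMorphism.Build R (HZ X) rho rhoM.
pose rhoF : {rmorphism R -> HZ X} := HB.pack rho rhoA rhoR.
by exists rhoF.
Qed.

(** [combine], read on formal sums instead of coordinate vectors, is bijective
    and by the choice of rho linear over R. *)
Lemma Mrep_iso_ex : exists (V : klcrep R) (f : linhom (Mrep V) M),
  @is_iso (modcat R) _ _ f.
Proof.
have [rho rhoP] := representation_ex.
pose V := Klcrep rho.
pose f (v : Mrep V) : M := combine (coords v).
have f_lin : linear f.
  by move=> r v w; rewrite /f coordsD coords_scale raddfD /= rhoP.
pose fL : {linear Mrep V -> M} :=
  HB.pack f (GRing.isLinear.Build R (Mrep V) M _ f f_lin).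
have f_inj : injective f by move=> v w /combine_inj /(can_inj (@coordsK X)).
have [g gK] : exists g : M -> Mrep V, cancel g f.
  have /choice[g gK] : forall v, exists w, f w = v.
    move=> v; have [c cv] := combine_surj v.
    by exists (of_coords c); rewrite /f of_coordsK.
  by exists g.
have g_lin : linear g.
  by move=> r v w; apply: f_inj; rewrite f_lin !gK.
pose gL : {linear M -> Mrep V} :=
  HB.pack g (GRing.isLinear.Build R M (Mrep V) _ g g_lin).
exists V, fL, gL; split; apply: linhomP => v; last exact: gK.
by apply: f_inj; exact: gK.
Qed.

End EssSurj.

(** The indexing set of the representation is 'I_n, whose elements are numbered
    by 'I_#|'I_n|; the basis is reindexed accordingly. *)
Lemma F_R_ess_surj : ess_surj (F_R R).
Proof.
move=> [M [fgM [n [e eP]]]].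
have [e' eP'] : exists e' : 'I_#|'I_n| -> M,
    forall v, exists! c : {ffun 'I_#|'I_n| -> int}, v = \sum_i e' i *~ c i.
  by rewrite card_ord; exists e.
have [V [f fiso]] := Mrep_iso_ex eP'.
by exists V, f.
Qed.

End FunctorF.

(** * Additivity of the module categories, and the equivalences *)

Lemma R_free_additive (R : pzRingType) : is_additive_category (R_free R).
Proof.
apply: full_subcat_additive.
  exists ('rV[R]_0 : lmodType R); first exact: modcat_zero.
  by split; [exact: rV0_finitely_generated | exact: rV0_free].
move=> M N [fgM freeM] [fgN freeN].
have bi := modcat_biproduct M N.
do 5!eexists; split; first exact: bi.
by split; [exact: prod_finitely_generated | exact: prod_free].
Qed.

Lemma R_free_flat_additive (R : pzRingType) :
  is_additive_category (R_free_flat R).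
Proof.
have [[Z zeroZ] biprod] := R_free_additive R; apply: full_subcat_additive.
  by exists Z => //; apply: flat_zero; apply: (zeroZ Z).1.
move=> M N flatM flatN.
have [S [i1 [i2 [p1 [p2 bi]]]]] := biprod M N.
exists S, i1, i2, p1, p2; split=> //.
exact: (flat_biproduct (i1 := i1) (i2 := i2) (p1 := p1) (p2 := p2)) flatM flatN.
Qed.

Theorem proposition5p13 (R : pzRingType) :
  is_additive_equivalence (F_R R) /\
  exists F_R_flat : forall V : Klcrep_cat R, flat_rep V -> flat_free (F_R R V),
    is_additive_equivalence
      (restrict_functor F_R_flat : functor (Klcrep_flat R) (R_free_flat R)).
Proof.
split.
  apply: ff_ess_surj_additive_equivalence.
  - exact: F_R_full.
  - exact: F_R_faithful.
  - exact: F_R_ess_surj.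
  - exact: F_R_additive.
  exact: R_free_additive.
(* Flatness of V is by definition flatness of the module F_R V. *)
exists (fun V flatV => flatV).
apply: ff_ess_surj_additive_equivalence.
- by move=> V W; apply: F_R_full.
- by move=> V W; apply: F_R_faithful.
- apply: restrict_ess_surj => //; last exact: F_R_ess_surj.
  by move=> M N f; apply: flat_iso.
- by move=> V W; apply: F_R_additive.
exact: R_free_flat_additive.
Qed.
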